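(* Let $G=(V,E)$ be a connected graph with chromatic number $2$, let $\emptyset\ne V_c\subsetneq V$, and let $g:V_c\to\{0,1\}$ be such that no two adjacent vertices of $V_c$ have the same value under $g$. Let $\phi_0,\phi_1:V\to\{0,1\}$ be the two proper $2$-colourings of $G$, and for $i=0,1$ let $V_{\phi_i}=\{v\in V_c : g(v)=\phi_i(v)\}$. Suppose $|V_{\phi_0}|=1$ or $|V_{\phi_1}|=1$. If $f$ is a maximum contrast greyscale for the $\{0,1\}$-restricted maximum contrast problem on $G$ with initial colouring $g$, then $\mathrm{Im}(f)\subseteq\{0,\frac12,1\}$.
   Context: Graphs are finite, undirected and simple. A greyscale of $G=(V,E)$ is a map $f:V\to[0,1]$ with $0,1\in \mathrm{Im}(f)$. For $e=\{u,v\}\in E$ put $\widehat f(e)=|f(u)-f(v)|$. The contrast vector $\mathcal C_f$ is the vector of all values $\widehat f(e)$, $e\in E$, listed in ascending order; contrast vectors are compared lexicographically. A greyscale $f$ is compatible with $g$ if $f(u)=g(u)$ for all $u\in V_c$. A maximum contrast greyscale for the $\{0,1\}$-restricted maximum contrast problem ($\{0,1\}$-RMACG) with data $(G,V_c,g)$ is a greyscale compatible with $g$ whose contrast vector is the lexicographic maximum among all greyscales of $G$ compatible with $g$. *)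

(* Defs.v *)
From mathcomp Require Import all_boot all_order all_algebra.
From mathcomp Require Import reals.

Set Implicit Arguments.
Unset Strict Implicit.
Unset Printing Implicit Defensive.

Import Order.TTheory GRing.Theory Num.Theory.
Local Open Scope ring_scope.

Record sgraph := SGraph {
  vertex :> finType;
  adj : rel vertex;
  adj_sym : symmetric adj;
  adj_irrefl : irreflexive adj }.

Definition connected (G : sgraph) : Prop :=
  forall u v : G, connect (@adj G) u v.

Definition edges (G : sgraph) : {set {set G}} :=
  [set [set p.1; p.2] | p : G * G & adj p.1 p.2].

Definition proper_colouring (G : sgraph) (C : eqType) (c : G -> C) : bool :=
  [forall u, forall v, adj u v ==> (c u != c v)].

Definition colourable (G : sgraph) (k : nat) : bool :=
  [exists c : {ffun G -> 'I_k}, proper_colouring c].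

Lemma colourable_card (G : sgraph) : exists k, colourable G k.
Proof.
exists #|G|; apply/existsP; exists [ffun v => enum_rank v].
apply/forallP => u; apply/forallP => v; apply/implyP => uv.
rewrite !ffunE (inj_eq enum_rank_inj); apply/eqP => e.
by rewrite e adj_irrefl in uv.
Qed.

Definition chromatic_number (G : sgraph) : nat := ex_minn (colourable_card G).

Section Greyscales.
Variables (R : realType) (G : sgraph).
Implicit Types (f h : G -> R) (e : {set G}).

Definition greyscale f : Prop :=
  [/\ forall v, 0 <= f v <= 1, exists v, f v = 0 & exists v, f v = 1].

(* The last branch is never taken on an edge; the value does not depend on the
   order of the enumeration (edge_contrast2). *)
Definition edge_contrast f e : R :=
  if enum e is [:: u; v] then `|f u - f v| else 0.

Lemma edge_contrast2 f u v :
  adj u v -> edge_contrast f [set u; v] = `|f u - f v|.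
Proof.
move=> uv; have nuv : u != v by apply: contraTneq uv => ->; rewrite adj_irrefl.
have sz : size (enum [set u; v]) = 2 by rewrite -cardE cards2 nuv.
have un := enum_uniq [set u; v].
have mem w : (w \in enum [set u; v]) = (w == u) || (w == v).
  by rewrite mem_enum in_set2.
rewrite /edge_contrast.
case: (enum _) sz un mem => [|a [|b []]] //= _.
rewrite inE andbT => nab mem.
have := mem a; have := mem b; rewrite !inE !eqxx ?orbT /=.
move=> /esym/orP[] /eqP eb /esym/orP[] /eqP ea; subst; rewrite ?eqxx // in nab *.
by rewrite distrC.
Qed.

Definition contrast_vector f : seqlexi R :=
  sort <=%R [seq edge_contrast f e | e <- enum (edges G)].

Variables (Vc : {set G}) (g : {v : G | v \in Vc} -> bool).

Definition compatible f : Prop := forall v, f (val v) = (g v)%:R.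

Definition max_contrast_greyscale f : Prop :=
  [/\ greyscale f, compatible f &
      forall h, greyscale h -> compatible h ->
        (contrast_vector h <= contrast_vector f)%O].

(* V_phi, a set of elements of the subtype Vc *)
Definition agreement (phi : G -> bool) : {set {v : G | v \in Vc}} :=
  [set v | g v == phi (val v)].

End Greyscales.

(* Main.v *)
(** Let [w] be the only element of [Vc] on which [g] agrees with the colouring
    [phi].  The map equal to [g w] at [w], to 1/2 on the neighbours of [w] and
    to the opposite of [phi] elsewhere (or [phi] itself when [Vc] is reduced to
    [w]) is a compatible greyscale all of whose contrasts are at least 1/2, so
    all contrasts of the maximum [f] are at least 1/2.  Then rounding every
    value of [f] other than 1/2 to the nearest of 0 and 1 decreases no contrast,
    hence by maximality changes none; but it would strictly increase the
    contrast of any edge with an endpoint outside {0, 1/2, 1}. *)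

Require Import Defs.
From mathcomp Require Import all_boot all_order all_algebra.
From mathcomp Require Import reals.
From mathcomp Require Import lra.

Import Order.TTheory GRing.Theory Num.Theory.
Local Open Scope ring_scope.

(** * Lexicographic comparison of sorted lists *)

Section SortLexi.
Variable R : realDomainType.

Lemma lexi_nth_le (s t : seq R) : size s = size t ->
  (forall i, (i < size s)%N -> nth 0 s i <= nth 0 t i) ->
  ((s : seqlexi R) <= t)%O.
Proof.
elim: s t => [|x s IH] [|y t] //= [sz] le_st.
rewrite lexi_cons; have /= -> := le_st 0%N isT; apply/implyP => _.
by apply: IH => // i i_lt; apply: (le_st i.+1).
Qed.

(* The i-th entry of a sorted list is at most y iff more than i entries are. *)
Lemma sort_lexi_le (T : Type) (a b : T -> R) (r : seq T) :
  (forall e, a e <= b e) ->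
  ((sort <=%R (map a r) : seqlexi R) <= sort <=%R (map b r))%O.
Proof.
move=> le_ab; apply: lexi_nth_le; first by rewrite !size_sort !size_map.
move=> i; rewrite size_sort size_map => i_lt.
set y := nth 0 (sort _ (map b r)) i.
have sorted_sort (c : T -> R) : sorted <=%R (sort <=%R (map c r)).
  exact: sort_le_sorted.
have size_sort_map (c : T -> R) : size (sort <=%R (map c r)) = size r.
  by rewrite size_sort size_map.
rewrite (set_nth_default y) ?size_sort_map //.
apply: nth_count_le => //.
(* Since [a e <= b e], at least as many entries of [a] as of [b] are at most [y]; the first [i.+1]
   entries of the sorted [b]-list already are. *)
apply: (@leq_trans (count (<= y) (sort <=%R (map b r)))); last first.
  rewrite !count_sort !count_map; apply: sub_count => e /=.
  exact: le_trans.
rewrite -[sort _ _](cat_take_drop i.+1) count_cat.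
apply: leq_trans (leq_addr _ _).
have szt : size (take i.+1 (sort <=%R (map b r))) = i.+1.
  by rewrite size_takel // size_sort_map.
rewrite -{1}szt -[X in (X <= _)%N]count_predT leq_eqVlt; apply/orP; left.
apply/eqP/eq_in_count => x /(nthP y)[j]; rewrite szt ltnS => j_le <-.
have j_lt := leq_ltn_trans j_le i_lt.
rewrite nth_take // (set_nth_default 0) ?size_sort_map //; apply/esym.
by apply: (sorted_leq_nth (leT := <=%R) le_trans lexx 0 (sorted_sort b));
  rewrite ?inE ?size_sort_map.
Qed.

(** Equal sorted lists have equal sums, so the nonnegative differences [b e - a e] add up to 0 and
    all vanish. *)
Lemma sort_eq_map (T : eqType) (a b : T -> R) (r : seq T) :
  (forall e, a e <= b e) -> sort <=%R (map a r) = sort <=%R (map b r) ->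
  {in r, a =1 b}.
Proof.
move=> le_ab eq_ab.
have : \sum_(e <- r) (b e - a e) = 0.
  have pe : perm_eq (map a r) (map b r).
    by rewrite -(perm_sort <=%R) eq_ab perm_sort.
  rewrite sumrB -[X in X - _](big_map b xpredT id).
  by rewrite -[X in _ - X](big_map a xpredT id) (perm_big _ pe) subrr.
move=> /eqP; rewrite psumr_eq0; last by move=> e _; rewrite subr_ge0.
by move=> /allP sum0 e /sum0; rewrite subr_eq0 => /eqP.
Qed.

(** The heads of the sorted lists are their minima, and the lexicographic order compares these
    first. *)
Lemma sort_lexi_ge_all (s t : seq R) (c : R) :
  size s = size t -> all (>= c) s ->
  ((sort <=%R s : seqlexi R) <= sort <=%R t)%O -> all (>= c) t.
Proof.
move=> sz; rewrite -(all_sort (>= c) <=%R s) -(all_sort (>= c) <=%R t).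
have := sort_le_sorted t; have : size (sort <=%R s) = size (sort <=%R t).
  by rewrite !size_sort.
case: (sort _ s) (sort _ t) => [|x s'] [|y t'] //= _.
rewrite (path_sortedE le_trans) => /andP[/allP y_min _] /andP[cx _].
rewrite lexi_cons => /andP[xy _]; rewrite (le_trans cx xy) /=.
by apply/allP => z /y_min; apply/le_trans/(le_trans cx xy).
Qed.

End SortLexi.

(** * Edgewise consequences of maximality *)

Section Contrast.
Variables (R : realType) (G : sgraph) (Vc : {set G}).
Variable g : {v : G | v \in Vc} -> bool.
Implicit Types f h : G -> R.

Lemma edgesP (e : {set G}) :
  reflect (exists u v : G, adj u v /\ e = [set u; v]) (e \in edges G).
Proof.
apply: (iffP imsetP) => [[[u v]]|[u [v [uv ->]]]].
  by rewrite inE /= => uv ->; exists u, v.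
by exists (u, v); rewrite ?inE.
Qed.

Lemma max_contrast_ge (f h : G -> R) (c : R) :
  max_contrast_greyscale g f -> greyscale h -> compatible g h ->
  (forall u v, adj u v -> c <= `|h u - h v|) ->
  forall u v, adj u v -> c <= `|f u - f v|.
Proof.
move=> [_ _ f_max] gh ch h_ge u v uv.
have : all (>= c) [seq edge_contrast f e | e <- enum (edges G)].
  apply: (@sort_lexi_ge_all _ _ _ _ _ _ (f_max h gh ch)).
    by rewrite !size_map.
  apply/allP => x /mapP[e]; rewrite mem_enum => /edgesP[a [b [ab ->]]] ->.
  by rewrite edge_contrast2 //; apply: h_ge.
move=> /allP /(_ `|f u - f v|); apply; apply/mapP; exists [set u; v].
  by rewrite mem_enum; apply/edgesP; exists u, v.
by rewrite edge_contrast2.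
Qed.

Lemma max_contrast_eq (f h : G -> R) :
  max_contrast_greyscale g f -> greyscale h -> compatible g h ->
  (forall u v, adj u v -> `|f u - f v| <= `|h u - h v|) ->
  forall u v, adj u v -> `|f u - f v| = `|h u - h v|.
Proof.
move=> [_ _ f_max] gh ch fh u v uv.
(* [sort_eq_map] wants domination at all indices, also outside [edges G]. *)
pose b e := if e \in edges G then edge_contrast h e else edge_contrast f e.
have bh : map b (enum (edges G)) = map (edge_contrast h) (enum (edges G)).
  by apply/eq_in_map => e; rewrite mem_enum /b => ->.
have fb e : edge_contrast f e <= b e.
  rewrite /b; case: ifP => // /edgesP[x [y [xy ->]]].
  by rewrite !edge_contrast2 //; apply: fh.
have eq_fb : sort <=%R (map (edge_contrast f) (enum (edges G))) =
             sort <=%R (map b (enum (edges G))).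
  (* Domination gives one inequality, maximality of [f] the other. *)
  apply: (@le_anti _ (seqlexi R)); rewrite sort_lexi_le //= bh.
  exact: f_max.
have uvE : [set u; v] \in edges G by apply/edgesP; exists u, v.
have := @sort_eq_map _ _ _ _ _ fb eq_fb [set u; v].
by rewrite mem_enum /b uvE !edge_contrast2 //; apply.
Qed.

End Contrast.

(** * Rounding to 0, 1/2 and 1 *)

Section Rounding.
Variable R : realFieldType.

Definition round_half (x : R) : R :=
  if x < 2^-1 then 0 else if x == 2^-1 then 2^-1 else 1.

Lemma round_half_bound x : 0 <= round_half x <= 1.
Proof. by rewrite /round_half; case: ifP => _; [|case: ifP => _]; lra. Qed.

Lemma round_half0 : round_half 0 = 0.
Proof. by rewrite /round_half; case: ifP => //; lra. Qed.

Lemma round_half1 : round_half 1 = 1.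
Proof.
rewrite /round_half; case: ifP => [|_]; first lra.
by case: ifP => // /eqP; lra.
Qed.

(** Two points of [0, 1] at distance at least 1/2 lie on either side of 1/2, so rounding moves them
    apart, strictly unless both are fixed. *)
Lemma round_half_dist (x y : R) : 0 <= x <= 1 -> 0 <= y <= 1 ->
  2^-1 <= `|x - y| ->
  `|x - y| <= `|round_half x - round_half y| ?= iff
    ((x \in [:: 0; 2^-1; 1]) && (y \in [:: 0; 2^-1; 1])).
Proof.
wlog xy : x y / x <= y => [hwlog x01 y01|x01 y01].
  have [xy|/ltW yx] := leP x y; first exact: hwlog.
  by rewrite distrC [`|round_half x - _|]distrC andbC; apply: hwlog.
rewrite distrC ger0_norm ?subr_ge0 // => xy2.
rewrite [`|round_half x - _|]distrC ger0_norm; last first.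
  rewrite subr_ge0 /round_half.
  by case: (ltgtP x) => ?; case: (ltgtP y) => ?; lra.
rewrite /round_half !inE; split.
  by case: (ltgtP x) => ?; case: (ltgtP y) => ?; lra.
by apply/idP/idP; case: (ltgtP x) => ?; case: (ltgtP y) => ?; lra.
Qed.

End Rounding.

(** * Greyscales with all contrasts at least 1/2 *)

Section HalfContrast.
Variables (R : realType) (G : sgraph) (Vc : {set G}).
Variable g : {v : G | v \in Vc} -> bool.
Hypothesis G_conn : connected G.
Hypothesis Vc_neq0 : Vc != set0.
Hypothesis Vc_proper : Vc \proper [set: G].

(** [Vc] and its complement supply two distinct vertices, and a path from [x] to another vertex
    begins with an edge. *)
Lemma has_neighbour (x : G) : exists y, adj x y.
Proof.
have [y yx] : exists y, y != x.
  have [a aV] := set0Pn _ Vc_neq0.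
  have [_ [b _ bV]] := properP Vc_proper.
  have [ax|] := eqVneq a x; last by exists a.
  by exists b; apply: contraNneq bV => ->; rewrite -ax.
have /connectP[[|z p] /=] := G_conn x y; last by case/andP; exists z.
by move=> _ eyx; rewrite eyx eqxx in yx.
Qed.

Lemma half_contrast_max (f h : G -> R) :
  max_contrast_greyscale g f -> greyscale h -> compatible g h ->
  (forall u v, adj u v -> 2^-1 <= `|h u - h v|) ->
  forall v, f v \in [:: 0; 2^-1; 1].
Proof.
move=> f_max gh ch h_ge v.
have f_ge := @max_contrast_ge _ _ _ _ _ _ _ f_max gh ch h_ge.
have [[f01 [z fz] [o fo]] cf _] := f_max.
have dist x y (xy : adj x y) :=
  @round_half_dist R _ _ (f01 x) (f01 y) (f_ge x y xy).
have [y vy] := has_neighbour v.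
suff : `|f v - f y| = `|round_half R (f v) - round_half R (f y)|.
  by move=> /eqP; rewrite (dist v y vy).2 => /andP[].
apply: (@max_contrast_eq _ _ _ _ f (round_half R \o f) f_max) => //.
- split=> [u||]; first exact: round_half_bound.
  + by exists z; rewrite /= fz round_half0.
  + by exists o; rewrite /= fo round_half1.
- by move=> u; rewrite /= cf; case: (g u); rewrite ?round_half0 ?round_half1.
- by move=> x t xt; exact: (dist x t xt).1.
Qed.

Hypothesis g_proper :
  forall u v : {v : G | v \in Vc}, adj (val u) (val v) -> g u <> g v.
Variable phi : {ffun G -> bool}.
Hypothesis phi_proper : proper_colouring phi.

Lemma phi_adj (u v : G) : adj u v -> phi v = ~~ phi u.
Proof.
move: phi_proper => /forallP/(_ u)/forallP/(_ v)/implyP p /p.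
by case: (phi u) (phi v) => [] [].
Qed.

(** Neighbours of [w] share a colour, so no edge joins two vertices of value 1/2. An edge with one
    such end has contrast 1/2, and every other edge joins 0 to 1. *)
Lemma exists_half_contrast : #|agreement g phi| = 1%N ->
  exists h : G -> R, [/\ greyscale h, compatible g h &
    forall u v, adj u v -> 2^-1 <= `|h u - h v|].
Proof.
move=> /eqP/cards1P[w agr].
have gE u : g u = if u == w then phi (val u) else ~~ phi (val u).
  have /setP/(_ u) := agr; rewrite !inE.
  by case: (u == w) (g u) (phi (val u)) => [] [] [].
have grey (h : G -> R) (a b : G) (c : bool) : (forall v, 0 <= h v <= 1) ->
    h a = c%:R -> h b = (~~ c)%:R -> greyscale h.
  by move=> h01; case: c => /= ha hb; split=> //;
    [exists b|exists a|exists a|exists b].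
have dist_negb (c : bool) : 2^-1 <= `|c%:R - (~~ c)%:R : R|.
  by case: c => /=; rewrite ?subr0 ?sub0r ?normrN normr1; lra.
(* The case [Vc] = {[w]} is separate because the general map may then miss a value: on a star
   centred at [w] it takes only [phi w] and 1/2. *)
have [/existsP[u uw]|/existsPn only_w] := boolP [exists u, u != w]; last first.
  exists (fun v => (phi v)%:R); split.
  - have [t wt] := has_neighbour (val w).
    apply: (grey _ (val w) t (phi (val w))) => // [v|].
      by case: (phi v) => /=; lra.
    by rewrite (phi_adj _ _ wt).
  - by move=> v; have /negPn := only_w v; rewrite gE => ->.
  - by move=> a b /phi_adj ->; exact: dist_negb.
(* A constrained neighbour of [w] would satisfy [g v = ~~ phi v = phi w = g w]. Hence the value 1/2
   never conflicts with [g]. *)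
have w_nadj v : v != w -> adj (val w) (val v) = false.
  move=> vw; apply/negP => wv; apply: (g_proper _ _ wv).
  by rewrite !gE eqxx (negPf vw) (phi_adj _ _ wv) negbK.
pose h (v : G) : R := if v == val w then (phi v)%:R
  else if adj (val w) v then 2^-1 else (~~ phi v)%:R.
have hw : h (val w) = (phi (val w))%:R by rewrite /h eqxx.
exists h; split.
- have h01 v : 0 <= h v <= 1.
    by rewrite /h; case: ifP => _; [|case: ifP => _]; case: (phi v) => /=; lra.
  have hu : h (val u) = (~~ phi (val u))%:R.
    by rewrite /h (inj_eq val_inj) (negPf uw) w_nadj.
  (* The value opposite to [h w] is attained at [u] if [u] has the colour of [w]. Otherwise it is
     attained at a neighbour [t] of [u]: [t] has the colour of [w], so it is not adjacent to [w],
     and it differs from [w] by [w_nadj]. *)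
  have [phiuw|phiuw] := eqVneq (phi (val u)) (phi (val w)).
    by apply: (grey h (val w) (val u)) hw _ => //; rewrite hu phiuw.
  have [t ut] := has_neighbour (val u); have phit := phi_adj _ _ ut.
  have phitw : phi t = phi (val w).
    by rewrite phit; case: (phi (val u)) (phi (val w)) phiuw => [] [].
  apply: (grey h (val w) t) hw _ => //; rewrite /h ifN; last first.
    by apply: contraFneq (w_nadj u uw) => <-; rewrite adj_sym.
  rewrite ifN ?phitw //; apply/negP => /phi_adj.
  by rewrite phitw; case: (phi _).
- move=> v; rewrite /h (inj_eq val_inj) gE.
  by have [->|vw] := eqVneq v w; rewrite ?w_nadj.
have half_dist (c : bool) : 2^-1 <= `|c%:R - 2^-1 : R|.
  by case: c => /=; rewrite ?sub0r ?normrN ger0_norm; lra.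
move=> a b ab; have ba : adj b a by rewrite adj_sym.
have phib := phi_adj _ _ ab; rewrite /h.
have [eaw|aw] := eqVneq a (val w).
  have -> : (b == val w) = false.
    by apply: contraTF ab => /eqP ->; rewrite eaw adj_irrefl.
  by rewrite -eaw ab half_dist.
have [ebw|bw] := eqVneq b (val w).
  by rewrite -ebw ba distrC half_dist.
have [wa|_] := boolP (adj (val w) a).
  have [wb|_] := boolP (adj (val w) b); last by rewrite distrC half_dist.
  by move: phib; rewrite (phi_adj _ _ wa) (phi_adj _ _ wb); case: (phi _).
have [wb|_] := boolP (adj (val w) b); first exact: half_dist.
by rewrite phib; exact: dist_negb.
Qed.

End HalfContrast.

Theorem theorem5p6 (R : realType) (G : sgraph) (Vc : {set G})
    (g : {v : G | v \in Vc} -> bool) (phi0 phi1 : {ffun G -> bool})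
    (f : G -> R) :
  connected G ->
  chromatic_number G = 2%N ->
  Vc != set0 ->
  Vc \proper [set: G] ->
  (forall u v : {v : G | v \in Vc}, adj (val u) (val v) -> g u <> g v) ->
  proper_colouring phi0 ->
  proper_colouring phi1 ->
  phi0 <> phi1 ->
  #|agreement g phi0| = 1%N \/ #|agreement g phi1| = 1%N ->
  max_contrast_greyscale g f ->
  forall v : G, f v \in [:: 0; 2^-1; 1].
Proof.
move=> G_conn _ Vc_neq0 Vc_proper g_proper p0 p1 _ agr f_max.
have [phi phi_proper agr1] :
    exists2 phi : {ffun G -> bool}, proper_colouring phi &
      #|agreement g phi| = 1%N.
  by case: agr; [exists phi0|exists phi1].
have [h [gh ch h_ge]] := @exists_half_contrast R G Vc g G_conn Vc_neq0 Vc_proper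
  g_proper phi phi_proper agr1.
by apply: half_contrast_max f_max gh ch h_ge.
Qed.
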